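(* Let $q$ be a power of $2$ and $h>1$. (i) Let $\mathcal{A}$ be a KM-arc of type $tq^{h-1}$, $t>2$, in $\mathrm{PG}(2,q^h)$ with $tq^{h-1}$-nucleus $(0,0,1)$ that arises from some KM-arc $\mathcal{B}$ of type $t$ in $\mathrm{PG}(2,q)$ by Construction (C). If $\mathcal{A}$ is an elation KM-arc with elation line $X=0$, then $\mathcal{B}$ is an elation KM-arc with elation line $X=0$ and $t$-nucleus $(0,0,1)$. (ii) If $\mathcal{A}$ is an elation KM-arc of type $2q^{h-1}$ in $\mathrm{PG}(2,q^h)$ with $2q^{h-1}$-nucleus $(0,0,1)$ and with elation line $X=0$ that arises from a hyperoval $\mathcal{H}$ in $\mathrm{PG}(2,q)$ by Construction (B), then $\mathcal{H}$ is an elation hyperoval stabilised by a non-trivial elation with axis $X=0$ and centre $(0,0,1)$.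
   Context: Points have homogeneous coordinates $(X,Y,Z)$; affine points are those not on $X=0$. A KM-arc of type $t$ in $\mathrm{PG}(2,q)$ is a set of $q+t$ points such that every line meets it in $0$, $2$ or $t$ points (each value occurring); a line meeting it in $i$ points is an $i$-secant. A hyperoval is a KM-arc of type $2$. If $t>2$, all $t$-secants pass through one common point, the $t$-nucleus. Constructions (B) and (C) (Gács–Weiner). Let $I$ be a direct complement of $\mathbb{F}_q$ in the additive group of $\mathbb{F}_{q^h}$, $h>1$, and let $H$ be a KM-arc (possibly a hyperoval) in $\mathrm{PG}(2,q)$ with affine part $\{(1,x_k,y_k)\}$. Put $J=\{(1,x_k,y_k+i)\mid (1,x_k,y_k)\in H,\ i\in I\}\subset\mathrm{PG}(2,q^h)$. (B) If $H$ is a hyperoval and $(0,0,1)\notin H$, then $J$ extends uniquely (by points on $X=0$, possibly none) to a KM-arc of type $2q^{h-1}$ in $\mathrm{PG}(2,q^h)$, with $2q^{h-1}$-nucleus $(0,0,1)$. (C) If $H$ is a KM-arc of type $t>2$ with $t$-nucleus $(0,0,1)$, then $J$ extends uniquely (by points on $X=0$, possibly none) to a KM-arc of type $tq^{h-1}$ in $\mathrm{PG}(2,q^h)$, with $tq^{h-1}$-nucleus $(0,0,1)$. The resulting KM-arc is said to arise from $H$ by Construction (B), resp. (C). An elation with axis a line $\ell$ and centre a point $R\in\ell$ is a collineation fixing all points of $\ell$ and stabilising all lines through $R$. A KM-arc $\mathcal{A}$ of type $t>2$ is an elation KM-arc with elation line $\ell_\infty$ if for every $t$-secant $\ell\neq\ell_\infty$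 the group of elations with axis $\ell_\infty$ stabilising $\mathcal{A}$ is transitive on the points of $\mathcal{A}\cap\ell$ (any point of $\mathcal{A}\cap\ell$ can be mapped to any other one by an element of the group). A hyperoval is an elation hyperoval with elation line $\ell_\infty$ if it is stabilised by a non-trivial elation with axis $\ell_\infty$. *)

(* Defs.v *)
From HB Require Import structures.
From mathcomp Require Import all_boot all_order all_algebra all_fingroup.

Set Implicit Arguments.
Unset Strict Implicit.
Unset Printing Implicit Defensive.

Import GRing.Theory.
Local Open Scope ring_scope.

(* Subspaces of F^3 of vector dimension r, each represented by its canonical  *)
(* matrix <<U>>%MS, so that Leibniz equality is equality of subspaces. The    *)
(* points of PG(2,F) are those with r = 1, the lines those with r = 2.        *)
Record pgsub (F : finFieldType) (r : nat) := PGSub {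
  pgmx :> 'M[F]_3;
  _ : (<<pgmx>>%MS == pgmx) && (\rank pgmx == r)
}.

HB.instance Definition _ (F : finFieldType) (r : nat) :=
  [isSub for @pgmx F r].
HB.instance Definition _ (F : finFieldType) (r : nat) :=
  [Finite of pgsub F r by <:].

Notation pgpoint F := (pgsub F 1).
Notation pgline F := (pgsub F 2).

Lemma point_of_subproof (F : finFieldType) (v : 'rV[F]_3) :
  v != 0 -> (<< <<v>> >>%MS == <<v>>%MS) && (\rank <<v>>%MS == 1%N).
Proof. by move=> v0; rewrite genmx_id eqxx mxrank_gen rank_rV v0. Qed.

Lemma line_of_subproof (F : finFieldType) (c : 'cV[F]_3) :
  c != 0 ->
  (<< <<kermx c>> >>%MS == <<kermx c>>%MS) && (\rank <<kermx c>>%MS == 2%N).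
Proof.
move=> c0; rewrite genmx_id eqxx mxrank_gen mxrank_ker.
by rewrite -mxrank_tr rank_rV trmx_eq0 c0.
Qed.

Definition coords (F : finFieldType) (X Y Z : F) : 'rV[F]_3 :=
  \row_(i < 3) [:: X; Y; Z]`_i.

Lemma coords1_neq0 (F : finFieldType) (x y : F) : coords 1 x y != 0.
Proof. by apply/eqP => /rowP /(_ ord0) /eqP; rewrite !mxE oner_eq0. Qed.

Lemma coords001_neq0 (F : finFieldType) : coords (0 : F) 0 1 != 0.
Proof. by apply/eqP => /rowP /(_ ord_max) /eqP; rewrite !mxE oner_eq0. Qed.

Lemma coords100T_neq0 (F : finFieldType) : (coords (1 : F) 0 0)^T != 0.
Proof. by rewrite trmx_eq0 coords1_neq0. Qed.

(* The point (1, x, y). *)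
Definition affpt (F : finFieldType) (x y : F) : pgpoint F :=
  PGSub (point_of_subproof (coords1_neq0 x y)).

(* The point (0, 0, 1). *)
Definition pt001 (F : finFieldType) : pgpoint F :=
  PGSub (point_of_subproof (coords001_neq0 F)).

(* The line X = 0: all row vectors v with v *m (1, 0, 0)^T = 0. *)
Definition lineX0 (F : finFieldType) : pgline F :=
  PGSub (line_of_subproof (coords100T_neq0 F)).

Section Plane.

Variable F : finFieldType.
Implicit Types (A : {set pgpoint F}) (l m : pgline F) (P Q R N : pgpoint F).
Implicit Types (g : {perm pgpoint F}) (t : nat).

Definition pts l : {set pgpoint F} := [set P : pgpoint F | (P <= l)%MS].

Definition secant (i : nat) A l : Prop := #|A :&: pts l| = i.

Definition KM_arc t A : Prop :=
  [/\ #|A| = (#|F| + t)%N,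
      forall l, secant 0 A l \/ secant 2 A l \/ secant t A l
    & (exists l, secant 0 A l) /\ (exists l, secant 2 A l)
      /\ (exists l, secant t A l)].

Definition hyperoval A : Prop := KM_arc 2 A.

Definition nucleus t A N : Prop := forall l, secant t A l -> N \in pts l.

Definition collineation g : Prop := forall l, exists m, g @: pts l = pts m.

(* The identity is an elation for every axis and centre. *)
Definition elation l R g : Prop :=
  [/\ collineation g, R \in pts l, forall P, P \in pts l -> g P = P
    & forall m, R \in pts m -> g @: pts m = pts m].

Definition stabilises g A : Prop := g @: A = A.

(* Membership in the group of all elations with axis l (and arbitrary centre  *)
(* on l) that stabilise A.                                                    *)
Definition elation_stab l A g : Prop :=
  (exists R, elation l R g) /\ stabilises g A.

(* Elements of the group need not stabilise m, hence no use of [transitive].  *)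
Definition elation_KM_arc t l A : Prop :=
  [/\ KM_arc t A, (2 < t)%N
    & forall m, secant t A m -> m <> l ->
      forall P Q, P \in A :&: pts m -> Q \in A :&: pts m ->
      exists2 g, elation_stab l A g & g P = Q].

Definition elation_hyperoval l A : Prop :=
  hyperoval A /\ exists2 g, elation_stab l A g & g <> 1%g.

End Plane.

Section Constructions.

(* F is identified with a subfield of L through iota. *)
Variables (F L : finFieldType) (iota : {rmorphism F -> L}).
Implicit Types (I : {set L}) (H : {set pgpoint F}) (A : {set pgpoint L}).

Definition direct_complement I : Prop :=
  [/\ zmod_closed (mem I), (iota @: [set: F]) :&: I = [set 0]
    & forall z : L, exists a : F, exists2 i, i \in I & z = iota a + i].

Definition liftJ I H : {set pgpoint L} :=
  [set affpt (iota p.1) (iota p.2 + i)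
     | p in [set p : F * F | affpt p.1 p.2 \in H], i in I].

Definition extends_at_X0 (J A : {set pgpoint L}) : Prop :=
  J \subset A /\ A :\: J \subset pts (lineX0 L).

(* Here #|L| = #|F| ^ h is understood. By a theorem of Gacs and Weiner there  *)
(* is exactly one such A for given H and I.                                   *)
Definition arises_by_B (h : nat) H A : Prop :=
  [/\ hyperoval H, pt001 F \notin H
    & exists I, [/\ direct_complement I, KM_arc (2 * #|F| ^ h.-1) A
                  & extends_at_X0 (liftJ I H) A]].

Definition arises_by_C (h t : nat) H A : Prop :=
  [/\ KM_arc t H, (2 < t)%N, nucleus t H (pt001 F)
    & exists I, [/\ direct_complement I, KM_arc (t * #|F| ^ h.-1) A
                  & extends_at_X0 (liftJ I H) A]].

End Constructions.

(* Main.v *)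
(* An elation g with axis X = 0 acts on affine points as a translation. If it *)
(* stabilises A and maps (1,a,y) to (1,a,y'), where y and y' lie in the small *)
(* field F, then it is the translation by (0, y' - y). Since I is a direct    *)
(* complement of F, an affine point with coordinates in F lies on A exactly   *)
(* when it comes from H, so the same translation stabilises H. Such g exist   *)
(* because a vertical line with at least two affine points of H becomes a     *)
(* secant of A of maximal size; comparing cardinalities there also shows      *)
(* that in part (i) the point (0,0,1) is not on the small arc.                *)

Require Import Defs.
From HB Require Import structures.
From mathcomp Require Import all_boot all_order all_algebra all_fingroup.
From mathcomp Require Import ring zify.

Set Implicit Arguments.
Unset Strict Implicit.
Unset Printing Implicit Defensive.

Import GRing.Theory.
Local Open Scope ring_scope.

(** Both parts rest on one descent, [lift_elation_descent]: two affine points of the small arc on a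
    common vertical line yield a vertical translation of the small plane stabilising that arc.
    Upstairs, [lift_secant] makes a suitable elation available and [elation_translation] identifies
    it; [lift_affptP] and [complement_inj] then recover the points of the small arc. By
    [vertical_translation_elation] the resulting translation is an elation with centre (0,0,1). *)

Section Plane.

Variable F : finFieldType.
Implicit Types (l m : pgline F) (P Q R : pgpoint F) (g : {perm pgpoint F}).

(** * Points and lines in coordinates *)

Lemma pgsub_gen r (U : pgsub F r) : <<U>>%MS = U.
Proof. by case: U => U /= /andP[/eqP]. Qed.

Lemma pgsub_rank r (U : pgsub F r) : \rank U = r.
Proof. by case: U => U /= /andP[_ /eqP]. Qed.

(** Equal ranks turn inclusion into equality of row spaces, and canonical matrices turn that into
    Leibniz equality. *)
Lemma pgsub_sub_eq r (U V : pgsub F r) : (U <= V)%MS -> U = V.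
Proof.
move=> sUV; apply: val_inj => /=.
rewrite -[LHS]pgsub_gen -[RHS]pgsub_gen; apply/genmxP.
by rewrite -(geq_leqif (mxrank_leqif_eq sUV)) !pgsub_rank.
Qed.

Lemma vec_of_point P : exists2 v : 'rV[F]_3, v != 0 & (P :=: v)%MS.
Proof.
have /rowV0Pn[v vP v0] : (P : 'M_3) != 0 by rewrite -mxrank_eq0 pgsub_rank.
exists v => //; apply/eqmx_sym/eqmxP.
by rewrite -(geq_leqif (mxrank_leqif_eq vP)) pgsub_rank rank_rV v0.
Qed.

Definition point_of (v : 'rV[F]_3) (v0 : v != 0) : pgpoint F :=
  PGSub (point_of_subproof v0).

Lemma point_of_sub (v : 'rV[F]_3) (v0 : v != 0) n (U : 'M_(n, 3)) :
  (point_of v0 <= U)%MS = (v <= U)%MS.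
Proof. by rewrite /= genmxE. Qed.

Definition line_of (c : 'cV[F]_3) (c0 : c != 0) : pgline F :=
  PGSub (line_of_subproof c0).

Lemma sub_line_of (c : 'cV[F]_3) (c0 : c != 0) n (U : 'M_(n, 3)) :
  (U <= line_of c0)%MS = (U *m c == 0).
Proof. by rewrite /= genmxE; apply/sub_kermxP/eqP. Qed.

(** A nonzero column of the cokernel of [l] vanishes on [l]; its kernel also has dimension 2, so it
    is [l]. *)
Lemma line_eq l : exists2 c : 'cV[F]_3, c != 0 &
  forall n (U : 'M_(n, 3)), (U <= l)%MS = (U *m c == 0).
Proof.
have ck0 : cokermx l != 0.
  by rewrite -mxrank_eq0 mxrank_coker pgsub_rank.
have [j cj0] : exists j, col j (cokermx l) != 0.
  apply/existsP; apply: contraNT ck0 => /existsPn ck0.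
  apply/eqP/matrixP => i j; move/negPn/eqP/colP/(_ i): (ck0 j).
  by rewrite !mxE.
exists (col j (cokermx l)) => // n U.
have {1}->: l = line_of cj0; last exact: sub_line_of.
by apply: pgsub_sub_eq; rewrite sub_line_of colE mulmxA mulmx_coker mul0mx.
Qed.

Lemma coords_mul (X Y Z : F) (c : 'cV[F]_3) :
  (coords X Y Z *m c == 0)
  = (X * c 0 0 + Y * c 1 0 + Z * c (inord 2) 0 == 0).
Proof.
have E : (coords X Y Z *m c) 0 0 = X * c 0 0 + Y * c 1 0 + Z * c (inord 2) 0.
  rewrite !mxE !big_ord_recl big_ord0 !mxE /= addr0 addrA.
  by congr (_ * c _ 0 + _ * c _ 0 + _ * c _ 0); apply/val_inj; rewrite /= ?inordK.
rewrite -E; apply/eqP/eqP => [->|cE]; first by rewrite mxE.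
by apply/matrixP => i j; rewrite !ord1 cE mxE.
Qed.

Lemma coordsE (v : 'rV[F]_3) : v = coords (v 0 0) (v 0 1) (v 0 (inord 2)).
Proof.
apply/rowP => i; rewrite mxE; case: i => -[|[|[|//]]] /= lti;
  by congr (v _ _); apply/val_inj; rewrite /= ?inordK.
Qed.

Lemma coords_sub_lineX0 (X Y Z : F) :
  (coords X Y Z <= lineX0 F)%MS = (X == 0).
Proof. by rewrite sub_line_of coords_mul !mxE inordK //= mulr1 !mulr0 !addr0. Qed.

Lemma affpt_notin_X0 (x y : F) : affpt x y \notin pts (lineX0 F).
Proof. by rewrite inE point_of_sub coords_sub_lineX0 oner_eq0. Qed.

Lemma pt001_X0 : pt001 F \in pts (lineX0 F).
Proof. by rewrite inE point_of_sub coords_sub_lineX0. Qed.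

Lemma affptP P : P \notin pts (lineX0 F) -> exists x y, P = affpt x y.
Proof.
have [v v0 Pv] := vec_of_point P; rewrite inE Pv [v]coordsE coords_sub_lineX0.
set a := v 0 0 => a0; exists (a^-1 * v 0 1), (a^-1 * v 0 (inord 2)).
apply/esym/pgsub_sub_eq; rewrite point_of_sub Pv; apply/sub_rVP; exists a^-1.
apply/rowP => i; rewrite [in RHS](coordsE v) !mxE.
by case: i => -[|[|[|//]]] //= _; rewrite mulVf.
Qed.

Lemma affpt_inj (x y x' y' : F) : affpt x y = affpt x' y' -> x = x' /\ y = y'.
Proof.
move=> E; have : (coords 1 x y <= affpt x' y')%MS by rewrite -E /= genmxE.
rewrite /= genmxE => /sub_rVP[k /rowP kE].
have := kE 0; rewrite !mxE /= mulr1 => k1.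
have := kE 1; have := kE (inord 2).
by rewrite !mxE inordK //= -k1 !mul1r => -> ->.
Qed.

Lemma coords_eq0 (X Y Z : F) :
  (coords X Y Z == 0) = [&& X == 0, Y == 0 & Z == 0].
Proof.
apply/eqP/and3P => [/rowP E|[/eqP-> /eqP-> /eqP->]].
  have := E 0; have := E 1; have := E (inord 2).
  by rewrite !mxE inordK //= => -> -> ->.
by apply/rowP => -[[|[|[|//]]] i]; rewrite !mxE.
Qed.

(** * Vertical lines, that is, the lines through (0,0,1) other than X = 0 *)

Lemma vline_subproof (a : F) : (coords a (-1) 0)^T != 0.
Proof. by rewrite trmx_eq0 coords_eq0 oppr_eq0 oner_eq0 andbF. Qed.

Definition vline (a : F) : pgline F := line_of (vline_subproof a).

Lemma coords_sub_vline (a X Y Z : F) :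
  (coords X Y Z <= vline a)%MS = (Y == X * a).
Proof.
rewrite sub_line_of coords_mul !mxE inordK //= mulr0 addr0 mulrN1.
by rewrite subr_eq0 eq_sym.
Qed.

Lemma affpt_vline (a x y : F) : (affpt x y \in pts (vline a)) = (x == a).
Proof. by rewrite inE point_of_sub coords_sub_vline mul1r. Qed.

Lemma pt001_vline (a : F) : pt001 F \in pts (vline a).
Proof. by rewrite inE point_of_sub coords_sub_vline mul0r. Qed.

Lemma vline_neq_X0 (a : F) : vline a <> lineX0 F.
Proof.
by move=> E; have := affpt_notin_X0 a 0; rewrite -E affpt_vline eqxx.
Qed.

(** Passing through (0,0,1) kills the Z-coefficient of the equation; if the Y-coefficient vanished
    too, the line would be X = 0, so one can solve for Y. *)
Lemma vlineP m : pt001 F \in pts m -> m <> lineX0 F -> exists a, m = vline a.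
Proof.
have [c c0 cE] := line_eq m.
rewrite inE point_of_sub cE coords_mul !mul0r !add0r mul1r => /eqP c2 mX0.
have [c1|c1] := eqVneq (c 1 0) 0.
  case: mX0; apply/esym/pgsub_sub_eq; apply/row_subP => i.
  have: (row i (lineX0 F) <= lineX0 F)%MS by apply: row_sub.
  rewrite [row i _]coordsE coords_sub_lineX0 => /eqP->.
  by rewrite cE coords_mul c1 c2 mul0r !mulr0 !addr0.
exists (- (c 0 0 / c 1 0)); apply/esym/pgsub_sub_eq; apply/row_subP => i.
set a := - _; have: (row i (vline a) <= vline a)%MS by apply: row_sub.
rewrite [row i _]coordsE coords_sub_vline => /eqP->.
by rewrite cE coords_mul c2 mulr0 addr0 /a; apply/eqP; field.
Qed.

Lemma X0_vline P (a : F) :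
  P \in pts (lineX0 F) -> P \in pts (vline a) -> P = pt001 F.
Proof.
have [v v0 Pv] := vec_of_point P.
rewrite !inE !Pv [v]coordsE coords_sub_lineX0 coords_sub_vline => /eqP v00.
rewrite v00 mul0r => /eqP v01; apply: pgsub_sub_eq.
rewrite Pv genmxE [v]coordsE v00 v01; apply/sub_rVP; exists (v 0 (inord 2)).
by apply/rowP => -[[|[|[|//]]] i]; rewrite !mxE /= ?mulr0 ?mulr1.
Qed.

Definition vfiber (H : {set pgpoint F}) (a : F) : {set F} :=
  [set y | affpt a y \in H].

(** The only non-affine point of a vertical line is (0,0,1), which accounts for the boolean
    summand. *)
Lemma card_vline (H : {set pgpoint F}) (a : F) :
  #|H :&: pts (vline a)| = (#|vfiber H a| + (pt001 F \in H))%N.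
Proof.
rewrite (cardsD1 (pt001 F)) inE pt001_vline andbT addnC; congr (_ + _)%N.
have inj : injective (affpt a) by move=> y y' /affpt_inj[].
rewrite -(card_imset _ inj); apply: eq_card => P.
rewrite !inE; apply/and3P/imsetP => [[PN PH Pa]|[y]].
  have [PX|/affptP[x [y Pxy]]] := boolP (P \in pts (lineX0 F)).
    by case/eqP: PN; apply: (@X0_vline _ a); rewrite // inE.
  have xa : x = a by apply/eqP; rewrite -(affpt_vline a x y) -Pxy inE.
  by exists y; rewrite ?inE -?xa -?Pxy.
rewrite inE => ayH ->; split => //; last by have := affpt_vline a a y; rewrite inE eqxx.
by apply: contraNneq (affpt_notin_X0 a y) => ->; apply: pt001_X0.
Qed.

(** * Elations with axis X = 0 are translations on affine points *)

(* The line through (1,x,y) and (0,d1,d2). *)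
Lemma line_through (x y d1 d2 : F) : coords 0 d1 d2 != 0 ->
  exists l, forall X Y Z,
    (coords X Y Z <= l)%MS = (d2 * (Y - X * x) == d1 * (Z - X * y)).
Proof.
move=> d0; have c0 : (coords (d1 * y - d2 * x) d2 (- d1))^T != 0.
  apply: contraNneq d0 => /eqP; rewrite trmx_eq0 !coords_eq0 oppr_eq0.
  by case/and3P=> _ -> ->; rewrite eqxx.
exists (line_of c0) => X Y Z; rewrite sub_line_of coords_mul !mxE inordK //=.
by rewrite -[RHS]subr_eq0; congr (_ == 0); ring.
Qed.

(** The chord and the direction (d1, d2) are both orthogonal to the coefficients (c1, c2) of the
    line, hence proportional unless c1 = c2 = 0; then c0 = 0 as well, which is impossible. *)
Lemma chord_direction m (x y x' y' d1 d2 : F) :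
  (coords 1 x y <= m)%MS -> (coords 1 x' y' <= m)%MS ->
  (coords 0 d1 d2 <= m)%MS -> d2 * (x' - x) = d1 * (y' - y).
Proof.
have [c c0 cE] := line_eq m; rewrite !cE !coords_mul !mul1r mul0r add0r.
set c1 := c 1 0; set c2 := c (inord 2) 0 => /eqP E1 /eqP E2 /eqP E3.
have E4 : (x' - x) * c1 + (y' - y) * c2 = 0.
  by rewrite -[RHS](subrr 0) -{1}E2 -E1; ring.
have [c20|c20] := eqVneq c2 0; last first.
  apply: (mulIf c20); apply/eqP; rewrite -subr_eq0; apply/eqP.
  transitivity ((x' - x) * (d1 * c1 + d2 * c2)
                - d1 * ((x' - x) * c1 + (y' - y) * c2)); first ring.
  by rewrite E3 E4 !mulr0 subrr.
have [c10|c10] := eqVneq c1 0; last first.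
  apply: (mulIf c10); apply/eqP; rewrite -subr_eq0; apply/eqP.
  transitivity (d2 * ((x' - x) * c1 + (y' - y) * c2)
                - (y' - y) * (d1 * c1 + d2 * c2)); first ring.
  by rewrite E3 E4 !mulr0 subrr.
case/eqP: c0; rewrite c10 c20 !mulr0 !addr0 in E1.
by rewrite -[c]trmxK [c^T]coordsE !mxE E1 -/c1 -/c2 c10 c20;
  apply/eqP; rewrite trmx_eq0 coords_eq0 !eqxx.
Qed.

Lemma X0P P : P \in pts (lineX0 F) ->
  exists r1 r2, coords 0 r1 r2 != 0 /\ (P :=: coords 0 r1 r2)%MS.
Proof.
have [r r0 Pr] := vec_of_point P.
rewrite inE Pr [r]coordsE coords_sub_lineX0 => /eqP r00.
exists (r 0 1), (r 0 (inord 2)); have := coordsE r; rewrite {}r00 => <-.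
by split.
Qed.

(* As g permutes each parallel class, the displacements of two affine points  *)
(* P and Q agree modulo the direction of PQ; both being multiples of R, they  *)
(* are equal unless R lies on PQ, in which case a third point is compared     *)
(* with both.                                                                 *)
Lemma elation_translation R g : elation (lineX0 F) R g ->
  exists b c, forall x y, g (affpt x y) = affpt (x + b) (y + c).
Proof.
case=> gcol /X0P[r1 [r2 [r0 Rr]]] gX gR.
have gI P l (Pl : P \in pts l) : g P \in g @: pts l by apply: imset_f.
(* The line joining the point to the centre R = (0, r1, r2) is stabilised, so the displacement is a
   multiple of (r1, r2). *)
have gaff x y : exists b c,
    g (affpt x y) = affpt (x + b) (y + c) /\ r2 * b = r1 * c.
  have gPX : g (affpt x y) \notin pts (lineX0 F).
    apply: contra (affpt_notin_X0 x y) => gPX.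
    by rewrite -(perm_inj (gX _ gPX)).
  have [x' [y' gE]] := affptP gPX.
  have [l lE] := line_through x y r0.
  have Rl : R \in pts l by rewrite inE Rr lE !mul0r !subr0 mulrC.
  have Pl : affpt x y \in pts l.
    by rewrite inE point_of_sub lE !mul1r !subrr !mulr0.
  have := gI _ _ Pl; rewrite gR // gE inE point_of_sub lE !mul1r => /eqP E.
  by exists (x' - x), (y' - y); rewrite !subrKC.
have gshift x y z w b c b' c' :
    g (affpt x y) = affpt (x + b) (y + c) -> r2 * b = r1 * c ->
    g (affpt z w) = affpt (z + b') (w + c') -> r2 * b' = r1 * c' ->
    r2 * (z - x) != r1 * (w - y) -> b = b' /\ c = c'.
  move=> gP bc gQ bc' nd; set d1 := z - x in nd; set d2 := w - y in nd.
  have d0 : coords 0 d1 d2 != 0.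
    apply: contraNneq nd => /eqP; rewrite coords_eq0.
    by case/and3P=> _ /eqP-> /eqP->; rewrite !mulr0.
  have [l lE] := line_through x y d0; have [m lm] := gcol l.
  have Pl : affpt x y \in pts l.
    by rewrite inE point_of_sub lE !mul1r !subrr !mulr0.
  have Ql : affpt z w \in pts l.
    by rewrite inE point_of_sub lE !mul1r mulrC.
  (* The direction of PQ lies on the axis, hence is fixed, so the image line has the same
     direction. *)
  have Dl : point_of d0 \in pts l.
    by rewrite inE point_of_sub lE !mul0r !subr0 mulrC.
  have DX : point_of d0 \in pts (lineX0 F).
    by rewrite inE point_of_sub coords_sub_lineX0.
  have := gI _ _ Pl; have := gI _ _ Ql; have := gI _ _ Dl.
  rewrite gP gQ gX // lm !inE !point_of_sub => Dm Qm Pm.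
  have E := chord_direction Pm Qm Dm.
  have E' : d2 * (b' - b) = d1 * (c' - c).
    have -> : b' - b = z + b' - (x + b) - d1 by rewrite /d1; ring.
    have -> : c' - c = w + c' - (y + c) - d2 by rewrite /d2; ring.
    by rewrite mulrBr E [RHS]mulrBr [d2 * d1]mulrC.
  have E'' : r2 * (b' - b) = r1 * (c' - c) by rewrite !mulrBr bc bc'.
  rewrite -subr_eq0 in nd.
  (* The difference of displacements solves a homogeneous 2 by 2 system whose determinant, up to
     sign, is the nonzero quantity in [nd]. *)
  split; apply/eqP; rewrite eq_sym -subr_eq0 -(mulrI_eq0 _ (mulfI nd)); apply/eqP.
    transitivity (d1 * (r2 * (b' - b)) - r1 * (d2 * (b' - b))); first ring.
    by rewrite E' E''; ring.
  transitivity (r2 * (d1 * (c' - c)) - d2 * (r1 * (c' - c))); first ring.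
  by rewrite -E' -E''; ring.
have [s [t st]] : exists s t, r2 * s != r1 * t.
  have [r20|r20] := eqVneq r2 0; last first.
    by exists 1, 0; rewrite mulr1 mulr0.
  exists 0, 1; rewrite mulr1 mulr0 eq_sym; apply: contraNneq r0 => ->.
  by rewrite coords_eq0 r20 !eqxx.
have [b [c [g0 bc]]] := gaff 0 0; exists b, c => x y.
have [b' [c' [gxy bc']]] := gaff x y.
have [xy|xy] := eqVneq (r2 * x) (r1 * y); last first.
  by have [|-> ->] := gshift _ _ _ _ _ _ _ _ g0 bc gxy bc'; rewrite // !subr0.
have [b1 [c1 [gst bc1]]] := gaff s t.
have [|-> ->] := gshift _ _ _ _ _ _ _ _ g0 bc gst bc1; first by rewrite !subr0.
have [|<- <- //] := gshift _ _ _ _ _ _ _ _ gxy bc' gst bc1.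
by rewrite !mulrBr xy (inj_eq (addIr _)).
Qed.

(** * Invertible matrices as collineations, and translations among them *)

Section Homography.

Variables (M : 'M[F]_3) (Mu : M \in unitmx).

Lemma homog_subproof r (U : pgsub F r) :
  (<< <<U *m M>> >>%MS == <<U *m M>>%MS) && (\rank <<U *m M>>%MS == r).
Proof.
by rewrite genmx_id eqxx mxrank_gen mxrankMfree ?row_free_unit // pgsub_rank /=.
Qed.

Definition homog r (U : pgsub F r) : pgsub F r := PGSub (homog_subproof U).

Lemma homog_sub r s (U : pgsub F r) (V : pgsub F s) :
  (homog U <= homog V)%MS = (U <= V)%MS.
Proof. by rewrite /= !genmxE submxMfree ?row_free_unit. Qed.

Lemma homog_inj r : injective (@homog r).
Proof. by move=> U V E; apply: pgsub_sub_eq; rewrite -homog_sub E. Qed.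

Definition homog_perm : {perm pgpoint F} := perm (@homog_inj 1).

Lemma homog_perm_pts l : homog_perm @: pts l = pts (homog l).
Proof.
apply/setP=> P; rewrite -[P](permKV homog_perm) mem_imset; last exact: perm_inj.
by rewrite !inE [in RHS]permE homog_sub.
Qed.

End Homography.

Section Translation.

Variables b c : F.
Let u : 'cV[F]_3 := (coords 1 0 0)^T.
Let r : 'rV[F]_3 := coords 0 b c.

(** Since r u = 0, the matrix u r squares to zero and 1 - u r is the inverse. The matrix 1 + u r
    adds to a vector v its X-coordinate times (0, b, c). *)
Lemma translation_unit : 1%:M + u *m r \in unitmx.
Proof.
have ru : r *m u = 0.
  by apply/eqP; rewrite coords_mul !mxE inordK //= !mulr0 mul0r !addr0.
apply: (@mulmx1_unit _ _ _ (1%:M - u *m r) _).1.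
rewrite mulmxDl mul1mx mulmxBr mulmx1 mulmxA -(mulmxA u) ru mulmx0 mul0mx.
by rewrite subr0 subrK.
Qed.

Definition translation : {perm pgpoint F} := homog_perm translation_unit.

Lemma translation_affpt x y :
  translation (affpt x y) = affpt (x + b) (y + c).
Proof.
rewrite permE; apply: pgsub_sub_eq; rewrite /= !genmxE.
rewrite (eqmxMr _ (genmxE _)) mulmxDr mulmx1 mulmxA.
suff -> : coords 1 x y *m u = 1%:M.
  rewrite mul1mx (_ : _ + _ = coords 1 (x + b) (y + c)) //.
  by apply/rowP => -[[|[|[|//]]] i]; rewrite !mxE /= ?addr0.
apply/matrixP=> i j; rewrite !ord1 !mxE !big_ord_recl big_ord0 !mxE /=.
by rewrite !mulr0 !addr0 mulr1.
Qed.

Lemma translation_X0 P : P \in pts (lineX0 F) -> translation P = P.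
Proof.
rewrite inE sub_line_of => /eqP Pu; rewrite permE; apply: pgsub_sub_eq.
by rewrite /= genmxE mulmxDr mulmx1 mulmxA Pu mul0mx addr0.
Qed.

(** A line through R contains r, and vectors move only by multiples of r. *)
Lemma translation_elation R : R \in pts (lineX0 F) -> (r <= R)%MS ->
  elation (lineX0 F) R translation.
Proof.
move=> RX rR; split=> //.
- by move=> l; exists (homog translation_unit l); apply: homog_perm_pts.
- exact: translation_X0.
move=> m; rewrite inE homog_perm_pts => Rm; congr pts.
apply: pgsub_sub_eq; rewrite /= genmxE mulmxDr mulmx1 addmx_sub //.
by rewrite mulmxA (submx_trans (submxMl _ _)) // (submx_trans rR).
Qed.

End Translation.

Lemma vertical_translation_elation (c : F) :
  elation (lineX0 F) (pt001 F) (translation 0 c).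
Proof.
apply: translation_elation; first exact: pt001_X0.
rewrite genmxE; apply/sub_rVP; exists c.
by apply/rowP => -[[|[|[|//]]] i]; rewrite !mxE /= ?mulr0 ?mulr1.
Qed.

End Plane.

(** * Passing between the small and the large plane *)

Section Lift.

Variables (F L : finFieldType) (iota : {rmorphism F -> L}) (I : {set L}).
Hypothesis cI : direct_complement iota I.
Variables (H : {set pgpoint F}) (A : {set pgpoint L}).
Hypothesis HA : extends_at_X0 (liftJ iota I H) A.

Lemma complement_inj (a b : F) (i j : L) : i \in I -> j \in I ->
  iota a + i = iota b + j -> a = b /\ i = j.
Proof.
case: cI => -[I0 IB] trivI _ iI jI E.
have E' : iota (a - b) = j - i by rewrite rmorphB -[iota a](addrK i) E; ring.
have : j - i \in (iota @: [set: F]) :&: I.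
  by rewrite inE IB // andbT -E' imset_f.
rewrite trivI inE => /eqP ji; split; last by apply/esym/subr0_eq.
by apply/subr0_eq/(fmorph_inj iota); rewrite E' ji rmorph0.
Qed.

Lemma card_complement : #|L| = (#|F| * #|I|)%N.
Proof.
case: (cI) => _ _ span.
rewrite -!cardsT -cardsX -(@card_in_imset _ _ (fun p => iota p.1 + p.2)).
  apply: eq_card => z; rewrite inE; apply/esym/imsetP.
  have [a [i iI ->]] := span z; exists (a, i); rewrite //= !inE //.
move=> [a i] [b j]; rewrite !inE /= => iI jI E.
by have [-> ->] := complement_inj iI jI E.
Qed.

(** The extension adds points on X = 0 only, so every affine point of [A] already lies in the lift
    of [H]. *)
Lemma lift_affptP (a : F) (z : L) :
  reflect (exists2 y, affpt a y \in H & exists2 i, i \in I & z = iota y + i)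
          (affpt (iota a) z \in A).
Proof.
case: HA => JA AX; apply: (iffP idP) => [zA|[y ayH [i iI ->]]]; last first.
  apply: (subsetP JA); apply/imset2P; exists (a, y) i => //.
  by rewrite inE.
have /imset2P[[b y] i] : affpt (iota a) z \in liftJ iota I H.
  apply: contraT => zJ; have := affpt_notin_X0 (iota a) z.
  by rewrite (subsetP AX) // inE zJ.
by rewrite inE /= => byH iI /affpt_inj[/fmorph_inj-> ->]; exists y => //; exists i.
Qed.

(** Each ordinate of [A] over [iota a] decomposes uniquely as an ordinate of [H] over [a] plus an
    element of [I]. *)
Lemma card_vfiber_lift (a : F) :
  #|vfiber A (iota a)| = (#|vfiber H a| * #|I|)%N.
Proof.
rewrite -cardsX -(@card_in_imset _ _ (fun p => iota p.1 + p.2)).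
  apply: eq_card => z; rewrite inE; apply/lift_affptP/imsetP => [[y ayH [i iI ->]]|].
    by exists (y, i) => //; rewrite !inE ayH.
  by case=> -[y i]; rewrite !inE /= => /andP[ayH iI] ->; exists y => //; exists i.
move=> [y i] [y' j]; rewrite !inE /= => /andP[_ iI] /andP[_ jI] E.
by have [-> ->] := complement_inj iI jI E.
Qed.

(* The line meets A in k|I| + d points, with k > 1 affine points of H below    *)
(* it and d <= 1; so this is at least 4, hence t|I|, and |I| > 1 forces d = 0. *)
Lemma lift_secant t (a : F) : (1 < #|I|)%N -> KM_arc (t * #|I|) A ->
  (1 < #|vfiber H a|)%N ->
  #|vfiber H a| = t /\ secant (t * #|I|) A (vline (iota a)).
Proof.
move=> I1 [_ secA _] k1; have := secA (vline (iota a)).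
rewrite /secant card_vline card_vfiber_lift.
move: #|vfiber H a| #|I| I1 k1 (_ \in _) => k n n1 k1 d.
have kn4 : (4 <= k * n)%N := leq_mul k1 n1.
case=> [|[|E]]; [by lia | by lia | split=> //].
have n0 := ltnW n1; have dn : (d < n)%N by apply: leq_ltn_trans n1; case: d {E}.
by rewrite -(mulnK t n0) -E divnMDl // divn_small ?addn0.
Qed.

Lemma lift_elation_descent t (a y y' : F) : (1 < #|I|)%N ->
    elation_KM_arc (t * #|I|) (lineX0 L) A -> (1 < #|vfiber H a|)%N ->
    affpt a y \in H -> affpt a y' \in H ->
  stabilises (translation 0 (y' - y)) H.
Proof.
move=> I1 [kmA _ elA] k1 yH y'H.
have [_ secA] := lift_secant I1 kmA k1.
have [[I0 _] _ _] := cI.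
have liftH x z : affpt x z \in H -> affpt (iota x) (iota z) \in A.
  by move=> xzH; apply/lift_affptP; exists z => //; exists 0; rewrite ?addr0.
have lA z : affpt a z \in H ->
    affpt (iota a) (iota z) \in A :&: pts (vline (iota a)).
  by move=> zH; rewrite in_setI liftH // affpt_vline eqxx.
(* The line over [a] is a secant of maximal size other than the axis, so transitivity applies to the
   two lifted points. *)
have [g [[R Rg] gA] gy] := elA _ secA (@vline_neq_X0 _ _) _ _ (lA _ yH) (lA _ y'H).
have [b [c gT]] := elation_translation Rg.
move: gy; rewrite gT => /affpt_inj[b0 cE].
have {}b0 : b = 0 by apply: (addrI (iota a)); rewrite b0 addr0.
have {}cE : c = iota (y' - y) by rewrite rmorphB -cE; ring.
apply/eqP; rewrite eqEcard card_imset ?leqnn ?andbT; last exact: perm_inj.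
apply/subsetP => _ /imsetP[P PH ->].
have [PX|/affptP[x [z Pxz]]] := boolP (P \in pts (lineX0 F)).
  by rewrite translation_X0.
rewrite Pxz in PH *; rewrite translation_affpt addr0.
(* The image is on [A] and its ordinate lies in the small field, so by uniqueness its [I]-component
   is 0 and it comes from [H]. *)
have : g (affpt (iota x) (iota z)) \in A by rewrite -gA imset_f // liftH.
rewrite gT b0 addr0 cE -rmorphD => /lift_affptP[z' xz'H [i iI]].
by rewrite -[LHS]addr0 => /(complement_inj I0 iI)[->].
Qed.

End Lift.

Theorem theorem2p5 (q e h : nat) (F L : finFieldType)
    (iota : {rmorphism F -> L}) (hq : q = (2 ^ e)%N) (hh : (1 < h)%N)
    (hF : #|F| = q) (hL : #|L| = (q ^ h)%N) :
  (forall (t : nat) (A : {set pgpoint L}) (B : {set pgpoint F}),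
     (2 < t)%N ->
     KM_arc (t * q ^ h.-1) A ->
     nucleus (t * q ^ h.-1) A (pt001 L) ->
     KM_arc t B ->
     arises_by_C iota h t B A ->
     elation_KM_arc (t * q ^ h.-1) (lineX0 L) A ->
     elation_KM_arc t (lineX0 F) B /\ nucleus t B (pt001 F))
  /\
  (forall (A : {set pgpoint L}) (H : {set pgpoint F}),
     hyperoval H ->
     nucleus (2 * q ^ h.-1) A (pt001 L) ->
     elation_KM_arc (2 * q ^ h.-1) (lineX0 L) A ->
     arises_by_B iota h H A ->
     elation_hyperoval (lineX0 F) H /\
     exists g : {perm pgpoint F},
       [/\ elation (lineX0 F) (pt001 F) g, g <> 1%g & stabilises g H]).
Proof.
have q1 : (1 < q)%N by rewrite -hF card_finNzRing_gt1.
have cardI I : direct_complement iota I -> #|I| = (q ^ h.-1)%N.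
  move=> cI; apply/eqP; rewrite -(eqn_pmul2l (ltnW q1)) -{1}hF.
  by rewrite -(card_complement cI) hL -expnS prednK // ltnW.
have I1 : (1 < q ^ h.-1)%N.
  by rewrite -{1}(exp1n h.-1) ltn_exp2r //; move: hh; case: (h) => [|[]].
split=> [t A B t2 _ _ kmB|A H hypH _] => [[_ _ nucB [I [cI _ HA]]]|].
  rewrite -(cardI I cI) in I1 * => elA.
  split=> //; split=> // m mt mX P Q.
  have [a ma] := vlineP (nucB _ mt) mX.
  move: mt; rewrite ma /secant card_vline => kt.
  have k1 : (1 < #|vfiber B a|)%N by move: kt; case: (_ \in _) => /=; lia.
  (* The secant has t points including (0,0,1) if that is in [B], while [lift_secant] gives t affine
     points already. *)
  have NB : pt001 F \notin B.
    have [kmA _ _] := elA; have [k _] := lift_secant cI HA I1 kmA k1.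
    by move: kt; rewrite k; case: (_ \in _) => //=; lia.
  have affB R : R \in B :&: pts (vline a) -> exists2 y, R = affpt a y & R \in B.
    rewrite !in_setI => /andP[RB Ra].
    have [RX|/affptP[x [y Rxy]]] := boolP (R \in pts (lineX0 F)).
      by move: NB; rewrite -(X0_vline RX Ra) RB.
    by move: Ra; rewrite Rxy affpt_vline => /eqP <-; exists y; rewrite // -Rxy.
  move=> /affB[y -> yB] /affB[y' -> y'B].
  exists (translation 0 (y' - y)); last by rewrite translation_affpt addr0 subrKC.
  split; last exact: (lift_elation_descent cI HA I1 elA k1).
  by exists (pt001 F); apply: vertical_translation_elation.
move=> elA [_ NH [I [cI _ HA]]]; rewrite -(cardI I cI) in I1 elA.
suff [g [gE g1 gH]] : exists g : {perm pgpoint F},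
    [/\ elation (lineX0 F) (pt001 F) g, g <> 1%g & stabilises g H].
  split; last by exists g.
  by split=> //; exists g => //; split=> //; exists (pt001 F).
have [cardH secH _] := hypH.
(* All q + 2 points of [H] cannot lie on X = 0, which carries at most two of them. *)
have [P PH PX] : exists2 P, P \in H & P \notin pts (lineX0 F).
  apply/subsetPn; apply/negP => /setIidPl HX.
  by have := secH (lineX0 F); rewrite /secant HX cardH; lia.
have [a [y0 Pa]] := affptP PX; rewrite Pa in PH.
(* The vertical line contains a point of [H], hence two, and both are affine because (0,0,1) is not
   in [H]. *)
have k1 : (1 < #|vfiber H a|)%N.
  have := secH (vline a); rewrite /secant card_vline (negPf NH) addn0.
  have : (0 < #|vfiber H a|)%N by apply/card_gt0P; exists y0; rewrite inE.
  by lia.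
have [y [y' [yH y'H yy']]] := card_gt1P k1; rewrite !inE in yH y'H.
exists (translation 0 (y' - y)); split.
- exact: vertical_translation_elation.
- move=> /permP/(_ (affpt a y)); rewrite perm1 translation_affpt addr0 subrKC.
  by case/affpt_inj=> _ /eqP; rewrite eq_sym (negPf yy').
- exact: (lift_elation_descent cI HA I1 elA k1).
Qed.
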